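(* Let $p$ be a prime and let $G$ be a finite $p$-solvable group with a redundant Sylow $p$-subgroup. Then $\nu_p(G)\ge q^{p+1}$, where $q>1$ is the smallest prime power congruent to $1$ modulo $p$.
   Context: All groups are finite. For a finite group $G$ and a prime $p$, $\nu_p(G)$ denotes the number of Sylow $p$-subgroups of $G$. A $p$-element of $G$ is an element whose order is a power of $p$. A Sylow $p$-subgroup $P$ of $G$ is called redundant if every $p$-element of $G$ lies in a Sylow $p$-subgroup of $G$ different from $P$. A finite group is $p$-solvable if it has a normal series each of whose quotients is a $p$-group or a $p'$-group (a group of order not divisible by $p$). *)

(* Defs.v *)
From mathcomp Require Import all_boot all_fingroup all_solvable.

Set Implicit Arguments.
Unset Strict Implicit.
Unset Printing Implicit Defensive.

Local Open Scope group_scope.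

(* The series is 1 = G_0 <= G_1 <= ... <= G_n = G with s = [:: G_1; ...; G_n].
   Every term is normal in the whole group G; this gives G_i <| G_(i+1), so the
   quotients G_(i+1) / G_i are the genuine ones. *)
Definition p_solvable (p : nat) (gT : finGroupType) (G : {group gT}) : Prop :=
  exists2 s : seq {group gT},
    path (fun H K : {group gT} =>
            [&& H \subset K, K <| G & p.-group (K / H) || p^'.-group (K / H)])
         1%G s
  & last 1%G s = G.

Definition redundant_Sylow (p : nat) (gT : finGroupType) (G P : {group gT})
    : Prop :=
  p.-Sylow(G) P /\
  (forall x : gT, x \in G -> p.-elt x ->
     exists Q : {group gT}, [/\ p.-Sylow(G) Q, Q != P & x \in Q]).

Definition num_Sylow (p : nat) (gT : finGroupType) (G : {group gT}) : nat :=
  #|'Syl_p(G)|.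

Local Open Scope nat_scope.

Definition prime_power (q : nat) : Prop :=
  exists r k : nat, [/\ prime r, 0 < k & q = r ^ k].

(* Such a q always exists when p is prime: for any prime r != p, Fermat gives
   r ^ (p - 1) = 1 %[mod p]. *)
Definition smallest_prime_power_1_mod (p q : nat) : Prop :=
  [/\ 1 < q, prime_power q, q = 1 %[mod p]
    & forall m : nat, 1 < m -> prime_power m -> m = 1 %[mod p] -> q <= m].

(* Main.v *)
Require Import Defs.
From mathcomp Require Import all_boot all_fingroup all_solvable.
From mathcomp Require Import zify.

(** For a p-subgroup [X] of [G], let [lam X] be the number of Sylow p-subgroups
    of [G] containing [X]; so [lam 1] is the number of all Sylow p-subgroups.
    Redundancy of one Sylow p-subgroup means, up to conjugacy, that no cyclic
    p-subgroup [X] has [lam X = 1].  Choose [Q] minimal among the subgroups of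
    the given Sylow subgroup with [lam Q = 1].  Then [Q] is not cyclic, hence
    has at least [p.+1] maximal subgroups [M] ([card_maximal_noncyclic]), and
    [lam M > 1] for each of them.  The theorem follows from two facts:
    - [lam M > lam Q] forces [lam M >= q * lam Q] ([Sylows_over_gap]);
    - the product of the ratios [lam M / lam Q] over the maximal subgroups of
      [Q] is at most [lam 1 / lam Q] ([Sylows_over_comaximal]).

    In a p-solvable group both reduce to fixed points of coprime actions.
    Factoring out a normal p-subgroup does not change [lam], while factoring
    out a normal p'-subgroup [K] divides [lam X] by [#|'C_K(X)| / #|'C_K(S)|],
    where [S] is a Sylow p-subgroup ([card_Sylows_over_p'quotient]).  So [lam X]
    is, up to a constant factor, the product of the numbers of fixed points of
    [X] on the p'-factors of a p-series, and it is enough to prove the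
    corresponding facts for a p-group [Q] acting on one p'-group [V].

    Such a [V] has a [Q]-invariant Sylow r-subgroup [R] for every prime [r], and
    the r-part of [#|'C_V(X)|] is [#|'C_R(X)|] for all [X] contained in [Q], so
    [V] may be taken to be an r-group.  For the first fact, the index of
    ['C_R(Q)] in ['C_R(M)] is a power of [r], and it is 1 modulo [p] because
    [Q] acts on ['C_R(M)] with fixed points ['C_R(Q)].  For the second fact, the
    derived series reduces to abelian [R]; there the subgroups ['C_R(M)] are
    independent modulo ['C_R(Q)], because two distinct maximal subgroups
    generate [Q]. *)
Set Implicit Arguments.
Unset Strict Implicit.
Unset Printing Implicit Defensive.

Local Open Scope group_scope.

(** * Prime parts of integers *)
Lemma leq_of_partn (m n : nat) :
    (0 < m)%N -> (0 < n)%N ->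
    (forall r, prime r -> m`_r <= n`_r)%N -> (m <= n)%N.
Proof.
move=> m_gt0 n_gt0 le_mn; rewrite -[m](partnT m_gt0) -[n](partnT n_gt0).
rewrite (widen_partn _ (leq_maxl m n)) (widen_partn _ (leq_maxr m n)).
apply: leq_prod => r _; have [pr_r | npr_r] := boolP (prime r).
  by rewrite -!p_part le_mn.
have logn0 k : logn r k = 0%N by rewrite lognE (negPf npr_r).
by rewrite !logn0.
Qed.

(** * Invariant Sylow subgroups under a coprime action *)
Lemma card_cent_mod (p : nat) (gT : finGroupType) (A P : {group gT}) :
  p.-group P -> P \subset 'N(A) -> #|A| = #|'C_A(P)| %[mod p].
Proof. by move=> pP nAP; rewrite -afixJ -pgroup_fix_mod // astabsJ. Qed.

(** The number of Sylow r-subgroups of [V] divides [#|V|], so it is prime to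
    [p], and the p-group [P] must fix one of them. *)
Lemma invariant_Sylow (p r : nat) (gT : finGroupType) (V P : {group gT}) :
    prime p -> p.-group P -> p^'.-group V -> P \subset 'N(V) ->
  exists2 R : {group gT}, r.-Sylow(V) R & P \subset 'N(R).
Proof.
move=> pr_p pP p'V nVP.
have actP: [acts P, on 'Syl_r(V) | 'JG].
  apply/actsP=> x Px R; rewrite !inE -[in LHS](normsP nVP x Px).
  by rewrite pHallJ2.
have fix_mod := pgroup_fix_mod pP actP.
have p'Syl : ~~ (p %| #|'Syl_r(V)|).
  rewrite -prime_coprime // coprime_sym.
  apply: (coprime_dvdl (card_Syl_dvd r V)).
  by rewrite coprime_sym prime_coprime // -p'natE.
have [fix0 | [R]] := set_0Vmem 'Fix_('Syl_r(V) | 'JG)(P).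
  by rewrite fix0 cards0 mod0n in fix_mod; rewrite /dvdn fix_mod in p'Syl.
by rewrite inE afixJG inE => /andP[sylR nRP]; exists R.
Qed.

(** A maximal [P]-invariant r-subgroup [T] is a Sylow subgroup of its own
    normaliser, since that normaliser has a [P]-invariant Sylow r-subgroup,
    and hence [T] is a Sylow subgroup of [V]. *)
Lemma invariant_Sylow_superset (p r : nat) (gT : finGroupType)
    (V P S : {group gT}) :
    prime p -> p.-group P -> p^'.-group V -> P \subset 'N(V) ->
    r.-group S -> S \subset V -> P \subset 'N(S) ->
  exists R : {group gT}, [/\ r.-Sylow(V) R, P \subset 'N(R) & S \subset R].
Proof.
move=> pr_p pP p'V nVP rS sSV nSP.
pose inv_r (T : {group gT}) := [&& r.-group T, T \subset V & P \subset 'N(T)].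
have [T /maxgroupP[/and3P[rT sTV nTP] maxT] sST] :
    {T : {group gT} | maxgroup T inv_r & S \subset T}.
  by apply: maxgroup_exists; apply/and3P.
have nNP : P \subset 'N('N_V(T)) by rewrite normsI ?norms_norm.
have p'N : p^'.-group 'N_V(T) := pgroupS (subsetIl _ _) p'V.
have [R sylR nRP] := invariant_Sylow r pr_p pP p'N nNP.
have nsTN : T <| 'N_V(T) by rewrite /normal subsetI sTV normG subsetIr.
have sTR : T \subset R := normal_sub_max_pgroup (Hall_max sylR) rT nsTN.
have defR : R = T.
  apply: val_inj; apply: maxT => //; apply/and3P; split=> //.
    exact: pHall_pgroup sylR.
  exact: subset_trans (pHall_sub sylR) (subsetIl _ _).
rewrite {R}defR in sylR nRP sTR.
have [Q sylQ sTQ] := Sylow_superset sTV rT.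
have rQ := pHall_pgroup sylQ.
have defQ : Q :=: T.
  apply: nilpotent_sub_norm (pgroup_nil rQ) sTQ _.
  rewrite (sub_normal_Hall sylR nsTN) ?(pgroupS (subsetIl _ _) rQ) //.
  by rewrite setSI ?(pHall_sub sylQ).
by exists Q; rewrite defQ in sylQ *; split.
Qed.

(** If [R] is the conjugate of [T] by [v], then [P] and [P :^ v] are Sylow
    p-subgroups of the normaliser of [R] in [V <*> P].  Conjugating one to the
    other inside that normaliser corrects [v] to an element normalising [P],
    which then centralises [P] by coprimality. *)
Lemma invariant_Sylow_conj (p r : nat) (gT : finGroupType)
    (V P R T : {group gT}) :
    p.-group P -> p^'.-group V -> P \subset 'N(V) ->
    r.-Sylow(V) R -> P \subset 'N(R) -> r.-Sylow(V) T -> P \subset 'N(T) ->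
  exists2 c, c \in 'C_V(P) & R :=: T :^ c.
Proof.
move=> pP p'V nVP sylR nRP sylT nTP.
have coVP : coprime #|V| #|P| by rewrite coprime_sym (pnat_coprime pP).
have [v Vv defR] := Sylow_trans sylT sylR.
have VPE : V <*> P = V * P by rewrite norm_joinEr.
have sylP : p.-Sylow(V <*> P) P.
  rewrite pHallE joing_subr /= VPE (coprime_cardMg coVP).
  rewrite partnM ?cardG_gt0 // part_p'nat // mul1n.
  by rewrite part_pnat_id.
have VPv : v \in V <*> P by rewrite mem_gen // inE Vv.
have sylPv : p.-Sylow(V <*> P) (P :^ v) by rewrite pHallJ.
set L := 'N_(V <*> P)(R).
have sLVP : L \subset V <*> P := subsetIl _ _.
have sPL : P \subset L by rewrite subsetI joing_subr.
have sPvL : P :^ v \subset L.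
  by rewrite subsetI (pHall_sub sylPv) /= defR normJ conjSg.
have [l Ll defP] :=
  Sylow_trans (pHall_subl sPvL sLVP sylPv) (pHall_subl sPL sLVP sylP).
have := subsetP sLVP l Ll; rewrite VPE => /mulsgP[u y Vu Py def_l].
have nRu : u \in 'N(R).
  (* [l] and [P] both normalise [R], hence so does the [V]-part of [l]. *)
  have -> : u = l * y^-1 by rewrite def_l mulgK.
  rewrite groupM //; first by case/setIP: Ll.
  by rewrite groupV (subsetP nRP).
exists (v * u).
  rewrite -coprime_norm_cent // inE groupM //=; apply/normP.
  rewrite conjsgM; apply: (@conjsg_inj _ y).
  by rewrite -conjsgM -def_l -defP conjGid.
by rewrite conjsgM -defR (normP nRu).
Qed.

(** A Sylow r-subgroup of ['C_V(P)] lies in some [P]-invariant Sylow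
    r-subgroup of [V], which can be moved onto [R] by an element of
    ['C_V(P)]. *)
Lemma Sylow_cent (p r : nat) (gT : finGroupType) (V P R : {group gT}) :
    prime p -> p.-group P -> p^'.-group V -> P \subset 'N(V) ->
    r.-Sylow(V) R -> P \subset 'N(R) ->
  r.-Sylow('C_V(P)) 'C_R(P).
Proof.
move=> pr_p pP p'V nVP sylR nRP.
have [S sylS] := Sylow_exists r 'C_V(P).
have [sSV cSP] := subsetIP (pHall_sub sylS).
have nSP : P \subset 'N(S) by rewrite cents_norm // centsC.
have [T [sylT nTP sST]] :=
  invariant_Sylow_superset pr_p pP p'V nVP (pHall_pgroup sylS) sSV nSP.
have [c Cc defR] := invariant_Sylow_conj pP p'V nVP sylR nRP sylT nTP.
have sylSc : r.-Sylow('C_V(P)) (S :^ c) by rewrite pHallJ.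
have rC : r.-group 'C_R(P) := pgroupS (subsetIl _ _) (pHall_pgroup sylR).
have -> // : 'C_R(P) = S :^ c.
apply: (sub_pHall sylSc rC); last by rewrite setSI ?(pHall_sub sylR).
by rewrite subsetI defR conjSg sST (subset_trans (pHall_sub sylSc) (subsetIr _ _)).
Qed.

(** * Fixed points of comaximal families *)
(** Comaximality, rather than maximality of the members, is what passes to
    quotients of [P]: the images may coincide with [P]. *)
Definition comaximal (gT : finGroupType) (P : {group gT})
    (Ms : seq {group gT}) : bool :=
  all (fun M : {group gT} => M <| P) Ms
  && pairwise (fun M N : {group gT} => M * N == P) Ms.

Lemma comaximal_quotient (gT : finGroupType) (K P : {group gT})
    (Ms : seq {group gT}) :
    P \subset 'N(K) -> comaximal P Ms ->
  comaximal (P / K) [seq (M / K)%G | M : {group gT} <- Ms].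
Proof.
move=> nKP; elim: Ms => //= M Ms IH /andP[/= /andP[nsMP nsMs] /andP[coM coMs]].
have /andP[/= IHn IHc] : comaximal (P / K) [seq (M / K)%G | M : {group gT} <- Ms].
  by apply: IH; apply/andP.
rewrite /comaximal /= quotient_normal // IHn IHc /= andbT all_map.
apply: sub_all coM => N /= /eqP defP.
by rewrite -quotientMl ?defP // (subset_trans (normal_sub nsMP)).
Qed.

(** [D] is the product of all the ['C_A(M)].  The last clause, which says that
    a subgroup comaximal with all of [Ms] has no more fixed points in [D] than
    [P] itself, makes the induction work: applied to the next member [M] it
    says that ['C_A(M)] meets [D] in exactly ['C_A(P)]. *)
Lemma abelian_join_cents (gT : finGroupType) (A P : {group gT})
    (Ms : seq {group gT}) :
    coprime #|A| #|P| -> abelian A -> P \subset 'N(A) -> comaximal P Ms ->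
  exists D : {group gT},
    [/\ D \subset A, P \subset 'N(D),
        (#|'C_A(P)| * \prod_(M <- Ms) #|'C_A(M)|
           = #|D| * #|'C_A(P)| ^ size Ms)%N
      & forall N : {group gT}, N \subset P ->
          all (fun M : {group gT} => N * M == P) Ms ->
          'C_D(N) = 'C_A(P)].
Proof.
move=> coAP abA nAP; elim: Ms => [_ | M Ms IH].
  exists 'C_A(P)%G; split; rewrite ?subsetIl ?big_nil //.
    by rewrite normsI ?norms_cent ?normG.
  move=> N sNP _; rewrite -setIA.
  by rewrite (setIidPl (centS sNP)).
rewrite /comaximal /= => /andP[/andP[nsMP nsMs] /andP[coM coMs]].
have [|D [sDA nDP cardD centD]] := IH; first exact/andP.
have [sMP nMP] := andP nsMP.
have nCP : P \subset 'N('C_A(M)) by rewrite normsI ?norms_cent.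
have sCA : 'C_A(M) \subset A := subsetIl _ _.
have cDC : 'C_A(M) \subset 'C(D) := sub_abelian_cent2 abA sCA sDA.
exists (D <*> 'C_A(M))%G; split=> /=.
- by rewrite join_subG sDA.
- by rewrite normsY.
- rewrite big_cons mulnCA cardD expnS mulnA [RHS]mulnA; congr (_ * _)%N.
  rewrite cent_joinEr // mulnC mul_cardG; congr (_ * _)%N.
  by rewrite -(centD M) // setIA (setIidPl sDA).
move=> N sNP /andP[/eqP defP coN].
have coDN : coprime #|D| #|N| by rewrite (coprimeSg sDA) ?(coprimegS sNP).
have solD : solvable D := abelian_sol (abelianS sDA abA).
have [nND nNC] := (subset_trans sNP nDP, subset_trans sNP nCP).
rewrite cent_joinEr // coprime_cent_mulG ?(cents_norm cDC) // centD //.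
by rewrite -setIA -centM -(normC (subset_trans sNP nMP)) defP mulGid.
Qed.

(** The integer form of: the product of the indices of ['C_A(P)] in the
    ['C_A(M)] is at most its index in [A]. *)
Definition cent_bound (gT : finGroupType) (A P : {group gT})
    (Ms : seq {group gT}) : Prop :=
  (#|'C_A(P)| * \prod_(M <- Ms) #|'C_A(M)| <= #|A| * #|'C_A(P)| ^ size Ms)%N.

Lemma cent_bound_abelian (gT : finGroupType) (A P : {group gT})
    (Ms : seq {group gT}) :
    coprime #|A| #|P| -> abelian A -> P \subset 'N(A) -> comaximal P Ms ->
  cent_bound A P Ms.
Proof.
move=> coAP abA nAP coMs.
have [D [sDA _ cardD _]] := abelian_join_cents coAP abA nAP coMs.
by rewrite /cent_bound cardD leq_mul2r subset_leq_card ?orbT.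
Qed.

Lemma card_cent_quotient (gT : finGroupType) (A B X : {group gT}) :
    coprime #|A| #|X| -> solvable A -> B <| A -> X \subset 'N(B) ->
  #|'C_A(X)| = (#|'C_B(X)| * #|'C_(A / B)(X / B)|)%N.
Proof.
move=> coAX solA /andP[sBA nBA] nBX.
rewrite -(coprime_quotient_cent sBA nBX coAX solA).
rewrite card_quotient ?subIset ?nBA // -(LagrangeI 'C_A(X) B).
by rewrite setIAC (setIidPr sBA).
Qed.

(** Coprime fixed points are multiplicative along the derived subgroup, so the
    two sides of the bound are products of the sides for [A^`(1)] and for the
    abelian quotient. *)
Lemma cent_bound_solvable (gT : finGroupType) (A P : {group gT})
    (Ms : seq {group gT}) :
    coprime #|A| #|P| -> solvable A -> P \subset 'N(A) -> comaximal P Ms ->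
  cent_bound A P Ms.
Proof.
have [n] := ubnP #|A|; elim: n => // n IHn in A *.
move=> ltAn coAP solA nAP coMs.
have [-> | ntA] := eqVneq A 1%G.
  apply: cent_bound_abelian => //; rewrite ?cards1 ?coprime1n ?abelian1 //.
  exact: norms1.
set B := (A^`(1))%G.
have nsBA : B <| A := der_normal 1 A.
have ltBA : B \proper A := sol_der1_proper solA (subxx A) ntA.
have nBP : P \subset 'N(B) := char_norm_trans (der_char 1 A) nAP.
have coBP : coprime #|B| #|P| := coprimeSg (normal_sub nsBA) coAP.
have boundB : cent_bound B P Ms.
  apply: IHn => //; last exact: solvableS (normal_sub nsBA) solA.
  by rewrite (leq_trans (proper_card ltBA)).
have boundQ : cent_bound (A / B) (P / B) [seq (M / B)%G | M : {group gT} <- Ms].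
  apply: cent_bound_abelian; rewrite ?quotient_norms ?coprime_morph //.
    exact: der_abelian 0 A.
  exact: comaximal_quotient.
have sMP (M : {group gT}) : M \in Ms -> M \subset P.
  by case/andP: coMs => /allP nsMs _ /nsMs/normal_sub.
have cardC (X : {group gT}) : X \subset P ->
    #|'C_A(X)| = (#|'C_B(X)| * #|'C_(A / B)(X / B)|)%N.
  move=> sXP; apply: card_cent_quotient => //; first exact: coprimegS sXP coAP.
  exact: subset_trans sXP nBP.
rewrite /cent_bound cardC // (eq_big_seq _ (fun M h => cardC M (sMP M h))).
have cardA : (#|B| * #|A / B|)%N = #|A|.
  by rewrite card_quotient ?normal_norm // Lagrange ?normal_sub.
rewrite big_split /= mulnACA -cardA expnMn [leqRHS]mulnACA leq_mul //.
by move: boundQ; rewrite /cent_bound big_map size_map.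
Qed.

Lemma partn_prod_seq (pi : nat_pred) (I : Type) (s : seq I) (F : I -> nat) :
    (forall i, 0 < F i)%N ->
  ((\prod_(i <- s) F i)`_pi = \prod_(i <- s) (F i)`_pi)%N.
Proof.
move=> F_gt0; elim: s => [|i s IHs]; first by rewrite !big_nil partn1.
by rewrite !big_cons partnM ?IHs // prodn_gt0.
Qed.

Lemma card_cent_Sylow (p r : nat) (gT : finGroupType) (V P R : {group gT}) :
    prime p -> p.-group P -> p^'.-group V -> P \subset 'N(V) ->
    r.-Sylow(V) R -> P \subset 'N(R) ->
  forall X : {group gT}, X \subset P -> (#|'C_V(X)|`_r = #|'C_R(X)|)%N.
Proof.
move=> pr_p pP p'V nVP sylR nRP X sXP; apply/esym/card_Hall.
apply: (Sylow_cent pr_p (pgroupS sXP pP) p'V) => //.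
  exact: subset_trans nVP.
exact: subset_trans nRP.
Qed.

(** The bound is compared one prime [r] at a time: the r-parts of both sides are
    the two sides for an invariant Sylow r-subgroup, which is nilpotent, hence
    solvable. *)
Lemma cent_bound_p'group (p : nat) (gT : finGroupType) (V P : {group gT})
    (Ms : seq {group gT}) :
    prime p -> p.-group P -> p^'.-group V -> P \subset 'N(V) ->
    comaximal P Ms ->
  cent_bound V P Ms.
Proof.
move=> pr_p pP p'V nVP coMs.
have Cgt0 (M : {group gT}) : (0 < #|'C_V(M)|)%N by rewrite cardG_gt0.
apply: leq_of_partn => [||r pr_r].
- by rewrite muln_gt0 cardG_gt0 prodn_gt0.
- by rewrite muln_gt0 expn_gt0 !cardG_gt0.
have [R sylR nRP] := invariant_Sylow r pr_p pP p'V nVP.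
have cardC := card_cent_Sylow pr_p pP p'V nVP sylR nRP.
have sMP (M : {group gT}) : M \in Ms -> M \subset P.
  by case/andP: coMs => /allP nsMs _ /nsMs/normal_sub.
rewrite !partnM ?prodn_gt0 ?expn_gt0 ?cardG_gt0 // partn_prod_seq // partnX.
rewrite cardC // (eq_big_seq _ (fun M h => cardC M (sMP M h))).
rewrite -(card_Hall sylR); apply: cent_bound_solvable => //.
  rewrite (coprimeSg (pHall_sub sylR)) // coprime_sym.
  exact: pnat_coprime pP p'V.
exact: nilpotent_sol (pgroup_nil (pHall_pgroup sylR)).
Qed.

Lemma prime_power_gt1 (r n : nat) : prime r -> r.-nat n -> (1 < n)%N ->
  prime_power n.
Proof.
move=> pr_r r_n n_gt1; have n_gt0 : (0 < n)%N := ltnW n_gt1.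
exists r, (logn r n); split=> //; last by rewrite -p_part part_pnat_id.
rewrite logn_gt0 mem_primes pr_r n_gt0 /=; apply: contraLR n_gt1 => r'n.
rewrite -p'natE // in r'n; rewrite -leqNgt; case: n r_n r'n n_gt0 => // n rn r'n _.
by rewrite (pnat_1 rn r'n).
Qed.

(** For a prime [r] dividing the index of ['C_V(P)] in ['C_V(M)], the r-part of
    that index is the index of ['C_R(P)] in ['C_R(M)] for an invariant Sylow
    r-subgroup [R]: a nontrivial power of [r], congruent to 1 modulo [p] since
    the nontrivial orbits of [P] on ['C_R(M)] have sizes divisible by [p]. *)
Lemma cent_gap (p q : nat) (gT : finGroupType) (V P M : {group gT}) :
    prime p -> p.-group P -> p^'.-group V -> P \subset 'N(V) -> M <| P ->
    (forall m, 1 < m -> prime_power m -> m = 1 %[mod p] -> q <= m)%N ->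
  #|'C_V(M)| = #|'C_V(P)| \/ (q * #|'C_V(P)| <= #|'C_V(M)|)%N.
Proof.
move=> pr_p pP p'V nVP /andP[sMP nMP] q_min.
have sCC : 'C_V(P) \subset 'C_V(M) by rewrite setIS ?centS.
have [| lt_C] := eqVneq #|'C_V(M)| #|'C_V(P)|; [by left | right].
rewrite -(Lagrange sCC) mulnC leq_mul2l; apply/orP; right.
set n := #|'C_V(M) : 'C_V(P)|; have n_gt0 : (0 < n)%N := indexg_gt0 _ _.
have n_gt1 : (1 < n)%N.
  rewrite ltn_neqAle eq_sym n_gt0 andbT.
  by apply: contra lt_C; rewrite -(Lagrange sCC) -/n => /eqP->; rewrite muln1.
set r := pdiv n; have pr_r : prime r := pdiv_prime n_gt1.
apply: leq_trans (dvdn_leq n_gt0 (dvdn_part r n)).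
have [R sylR nRP] := invariant_Sylow r pr_p pP p'V nVP.
have cardC := card_cent_Sylow pr_p pP p'V nVP sylR nRP.
have p'C : (coprime p #|'C_V(P)|`_r)%N.
  rewrite coprime_sym (coprime_dvdl (dvdn_part r _)) //.
  rewrite coprime_sym prime_coprime // -p'natE //.
  exact: pgroupS (subsetIl _ _) p'V.
have nr_gt1 : (1 < n`_r)%N.
  rewrite ltn_neqAle eq_sym part_gt0 andbT partn_eq1 // p'natE // negbK.
  exact: pdiv_dvd.
apply: q_min => //; first exact: (prime_power_gt1 pr_r (part_pnat r n)).
have nCP : P \subset 'N('C_R(M)) by rewrite normsI ?norms_cent.
have := card_cent_mod pP nCP; rewrite -setIA (setIidPr (centS sMP)).
rewrite -!cardC // -(Lagrange sCC) partnM ?cardG_gt0 // -/n.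
move/eqP; rewrite eqn_mod_dvd; last by rewrite leq_pmulr ?part_gt0.
rewrite -{2}[(#|'C_V(P)|`_r)%N]muln1 -mulnBr.
by rewrite Gauss_dvdr // -eqn_mod_dvd ?part_gt0 // => /eqP.
Qed.

(** * Counting the Sylow subgroups over a p-subgroup *)
Definition Sylows_over (p : nat) (gT : finGroupType) (G X : {group gT}) :
    {set {group gT}} :=
  [set Q in 'Syl_p(G) | X \subset Q].

Lemma Sylows_overP (p : nat) (gT : finGroupType) (G X Q : {group gT}) :
  reflect (p.-Sylow(G) Q /\ X \subset Q) (Q \in Sylows_over p G X).
Proof. by rewrite !inE; apply: andP. Qed.

Lemma card_Sylows_over_pquotient (p : nat) (gT : finGroupType)
    (G K X : {group gT}) :
    p.-group K -> K <| G -> X \subset G ->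
  #|Sylows_over p G X| = #|Sylows_over p (G / K) (X / K)|.
Proof.
move=> pK nsKG sXG; have [sKG nKG] := andP nsKG.
have nKX := subset_trans sXG nKG.
have nsKSyl (Q : {group gT}) : p.-Sylow(G) Q -> K <| Q.
  move=> sylQ; apply: (normalS _ (pHall_sub sylQ) nsKG).
  exact: normal_sub_max_pgroup (Hall_max sylQ) pK nsKG.
rewrite -(card_in_imset (f := fun Q : {group gT} => (Q / K)%G)); last first.
  move=> Q1 Q2 /Sylows_overP[syl1 _] /Sylows_overP[syl2 _] /(congr1 val) /= eq12.
  by apply: val_inj; apply: quotient_inj eq12; apply: nsKSyl.
apply: eq_card => Qb; apply/imsetP/Sylows_overP => [[Q] | [sylQb sXQb]].
  case/Sylows_overP=> sylQ sXQ ->; rewrite pquotient_pHall ?(nsKSyl Q) //.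
  by rewrite quotientS.
exists [group of coset K @*^-1 Qb]; last by apply: val_inj; rewrite /= cosetpreK.
apply/Sylows_overP; rewrite -sub_quotient_pre //; split=> //.
by rewrite -(pquotient_pHall pK) ?normal_cosetpre //= cosetpreK.
Qed.

(** Taking images modulo [K] maps the Sylow subgroups of [G] over [X] onto those
    of [G / K] over [X / K].  The fibre through [Q0] is the orbit of [Q0] under
    ['C_K(X)], with stabiliser ['C_K(Q0)], whose order does not depend on the
    Sylow subgroup [Q0]. *)
Lemma card_Sylows_over_p'quotient (p : nat) (gT : finGroupType)
    (G K X S : {group gT}) :
    p^'.-group K -> K <| G -> p.-group X -> X \subset G -> p.-Sylow(G) S ->
  (#|Sylows_over p G X| * #|'C_K(S)|
     = #|Sylows_over p (G / K) (X / K)| * #|'C_K(X)|)%N.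
Proof.
move=> p'K nsKG pX sXG sylS; have [sKG nKG] := andP nsKG.
have nKX := subset_trans sXG nKG.
have tiK (Q : {group gT}) : p.-Sylow(G) Q -> K :&: Q = 1.
  move=> sylQ; rewrite setIC coprime_TIg //.
  exact: pnat_coprime (pHall_pgroup sylQ) p'K.
have nKSyl (Q : {group gT}) : p.-Sylow(G) Q -> Q \subset 'N(K).
  by move=> sylQ; apply: subset_trans (pHall_sub sylQ) nKG.
pose quo (Q : {group gT}) := (Q / K)%G.
rewrite -[#|Sylows_over p G X|]sum1_card.
rewrite (partition_big quo [in Sylows_over p (G / K) (X / K)]) /=; last first.
  move=> Q /Sylows_overP[sylQ sXQ]; apply/Sylows_overP.
  by rewrite quotientS // quotient_pHall ?nKSyl.
rewrite big_distrl -sum_nat_const; apply: eq_bigr => Qb.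
case/Sylows_overP=> sylQb sXQb /=.
(* The fibre is not empty: lift [Qb] to a Sylow subgroup of its preimage. *)
have [Q0 [sylQ0 sXQ0 defQb]] :
    exists Q : {group gT}, [/\ p.-Sylow(G) Q, X \subset Q & quo Q = Qb].
  pose L := [group of coset K @*^-1 Qb].
  have sXL : X \subset L by rewrite -sub_quotient_pre.
  have nKL : L \subset 'N(K) := normal_norm (normal_cosetpre _).
  have sLG : L \subset G.
    by rewrite -(quotientGK nsKG) cosetpreSK (pHall_sub sylQb).
  have [Q sylQ sXQ] := Sylow_superset sXL pX.
  have nKQ : Q \subset 'N(K) := subset_trans (pHall_sub sylQ) nKL.
  have QbE : Q / K = Qb.
    apply/esym/(sub_pHall (quotient_pHall nKQ sylQ) (pHall_pgroup sylQb)).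
      by rewrite -[gval Qb]cosetpreK quotientS ?(pHall_sub sylQ).
    by rewrite /= -[L / K]/(coset K @*^-1 Qb / K) cosetpreK.
  exists Q; split=> //; last exact: val_inj.
  rewrite pHallE (subset_trans (pHall_sub sylQ)) //=.
  rewrite -(card_Hall sylS) (card_isog (quotient_isog nKQ _)); last first.
    rewrite setIC coprime_TIg //.
    exact: pnat_coprime (pHall_pgroup sylQ) p'K.
  rewrite (card_isog (quotient_isog (nKSyl S sylS) (tiK S sylS))) /= QbE.
  by rewrite (card_Hall sylQb) (card_Hall (quotient_pHall (nKSyl S sylS) sylS)).
have nKQ0 := nKSyl _ sylQ0.
have <- : #|orbit 'JG 'C_K(X) Q0| = (\sum_(Q in Sylows_over p G X | quo Q == Qb) 1)%N.
  rewrite sum1_card; apply: eq_card => Q; apply/imsetP/andP=> [[k Ck ->] | [/=]].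
    have [Kk cXk] := setIP Ck.
    split=> /=.
      apply/Sylows_overP; rewrite /= pHallJ ?(subsetP sKG) //; split=> //.
      by rewrite -(normP (subsetP (cent_sub X) k cXk)) conjSg.
    rewrite -defQb; apply/eqP/val_inj => /=.
    by rewrite quotientJ ?(subsetP (normG K)) // coset_id // conjsg1.
  case/Sylows_overP=> sylQ sXQ /eqP QQb.
  have sQL : Q \subset Q0 <*> K.
    rewrite norm_joinEl // (normC nKQ0) -quotientSK ?nKSyl //.
    by rewrite -[Q / K]/(gval (quo Q)) QQb -defQb.
  have sLG : Q0 <*> K \subset G by rewrite join_subG (pHall_sub sylQ0).
  have sQ0L : Q0 \subset Q0 <*> K := joing_subl _ _.
  have [l] := Sylow_trans (pHall_subl sQ0L sLG sylQ0) (pHall_subl sQL sLG sylQ).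
  rewrite /= norm_joinEl // => /mulsgP[y k Qy Kk ->] defQ.
  rewrite conjsgM (conjGid Qy) in defQ.
  (* For [x] in [X], the commutator of [k] and [x] lies in [K :&: Q] = 1. *)
  exists k; last exact: val_inj.
  rewrite inE Kk /=; apply/centP=> x Xx; apply/commgP.
  rewrite -in_set1 -[[set 1]](tiK _ sylQ) inE; apply/andP; split.
    by rewrite commgEl groupMl ?groupV // memJ_norm // (subsetP nKX).
  have Qxk : x^-1 ^ k \in Q by rewrite defQ memJ_conjg groupV (subsetP sXQ0).
  by rewrite commgEr groupM // (subsetP sXQ).
rewrite -(card_orbit_stab 'JG 'C_K(X) Q0) /= astab1JG; congr (_ * _)%N.
have [g Gg ->] := Sylow_trans sylQ0 sylS.
have -> : #|'C_K(Q0 :^ g)| = #|'C_K(Q0)|.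
  by rewrite -[in LHS](normsP nKG g Gg) centJ -conjIg cardJg.
rewrite setIAC coprime_norm_cent //; last first.
  by rewrite coprime_sym (pnat_coprime (pHall_pgroup sylQ0)).
by rewrite -setIA (setIidPl (centS sXQ0)).
Qed.

(** * Induction on p-solvable groups *)
(** This is used for the tail of a series, with [A = K] its first term; the
    induction along the series moves [A]. *)
Lemma p_solvable_quotient_path (p : nat) (gT : finGroupType)
    (G K A : {group gT}) (s : seq {group gT}) :
    K <| G ->
    path (fun H L : {group gT} =>
            [&& H \subset L, L <| G & p.-group (L / H) || p^'.-group (L / H)])
         A s ->
    A <| G ->
  path (fun H L : {group coset_of K} =>
          [&& H \subset L, L <| G / K & p.-group (L / H) || p^'.-group (L / H)])
       (A / K)%G [seq (L / K)%G | L : {group gT} <- s].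
Proof.
move=> nsKG; elim: s A => //= L s IHs A /andP[/and3P[sAL nsLG piLA] sL] nsAG.
rewrite {}IHs // andbT quotientS //= quotient_normal //=.
have nAL : L \subset 'N(A) := subset_trans (normal_sub nsLG) (normal_norm nsAG).
have dvd_card : #|L / K / (A / K)| %| #|L / A|.
  rewrite !card_quotient ?quotient_norms //; apply: index_quotient.
  by rewrite subIset // (subset_trans (normal_sub nsLG) (normal_norm nsKG)).
by case/orP: piLA => /(pnat_dvd dvd_card) piLA; apply/orP; [left | right].
Qed.

(** The normal subgroup [K] is the first term of a p-series of [G]; the other
    terms induce a shorter p-series of [G / K]. *)
Lemma p_solvable_ind (p : nat)
    (Phi : forall gT : finGroupType, {group gT} -> Prop) :
    (forall gT, Phi gT 1%G) ->
    (forall (gT : finGroupType) (G K : {group gT}),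
       K <| G -> p.-group K \/ p^'.-group K -> Phi _ (G / K)%G -> Phi _ G) ->
  forall (gT : finGroupType) (G : {group gT}), p_solvable p G -> Phi _ G.
Proof.
move=> Phi1 PhiS gT G [s].
have [n] := ubnP (size s); elim: n => // n IHn in gT G s *.
case: s => [|K s] /=; first by move=> _ _ <-.
rewrite ltnS => lt_sn /andP[/and3P[_ nsKG piK] pathKs] lastG.
apply: (PhiS _ G K nsKG).
  have n1K : K \subset 'N(1) := norms1 K.
  by case/orP: piK; rewrite pquotient_pgroup ?pgroup1 //; [left | right].
apply: (IHn _ _ [seq (L / K)%G | L : {group gT} <- s]); first by rewrite size_map.
  have <- : (K / K)%G = 1%G by apply: val_inj; rewrite /= trivg_quotient.
  exact: p_solvable_quotient_path.
have <- : (K / K)%G = 1%G by apply: val_inj; rewrite /= trivg_quotient.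
by rewrite (last_map (fun L : {group gT} => (L / K)%G)) lastG.
Qed.

(** Multiplied by the power of [#|'C_K(S)|] that makes every
    [#|Sylows_over p G X|] into a product, the inequality for [G] is the product
    of the one for [G / K] and [cent_bound K P Ms]. *)
Lemma Sylows_over_comaximal (p : nat) (gT : finGroupType)
    (G P : {group gT}) (Ms : seq {group gT}) :
    prime p -> p_solvable p G -> p.-group P -> P \subset G -> comaximal P Ms ->
  (#|Sylows_over p G P| * \prod_(M <- Ms) #|Sylows_over p G M|
     <= #|Sylows_over p G 1| * #|Sylows_over p G P| ^ size Ms)%N.
Proof.
move=> pr_p solG; move: gT G solG P Ms.
apply: (p_solvable_ind (Phi := fun gT G => forall (P : {group gT}) Ms, _ -> _ -> _ -> _)).
  move=> gT P Ms _ /trivGP-> /andP[/allP nsMs _].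
  rewrite leq_mul2l; apply/orP; right.
  rewrite -(count_predT Ms) -iter_muln_1 -big_const_seq leq_eqVlt.
  by apply/orP; left; apply/eqP/eq_big_seq => M /nsMs/normal_sub/trivGP->.
move=> gT G K nsKG piK IH P Ms pP sPG coMs.
have nKP : P \subset 'N(K) := subset_trans sPG (normal_norm nsKG).
have sMP (M : {group gT}) : M \in Ms -> M \subset P.
  by case/andP: coMs => /allP nsMs _ /nsMs/normal_sub.
have {}IH := IH _ _ (quotient_pgroup K pP) (quotientS K sPG)
  (comaximal_quotient nKP coMs).
rewrite big_map size_map in IH.
have quo1 : (1 / K)%G = 1%G by apply: val_inj; rewrite /= quotient1.
case: piK => [pK | p'K].
  have card_quo (X : {group gT}) (sXG : X \subset G) :=
    card_Sylows_over_pquotient pK nsKG sXG.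
  rewrite !card_quo ?sub1G // quo1 (eq_big_seq _ (fun M h =>
    card_quo M (subset_trans (sMP M h) sPG))).
  exact: IH.
have [S sylS] := Sylow_exists p G.
have card_quo (X : {group gT}) (sXP : X \subset P) :=
  card_Sylows_over_p'quotient p'K nsKG (pgroupS sXP pP)
    (subset_trans sXP sPG) sylS.
have boundK := cent_bound_p'group pr_p pP p'K nKP coMs.
have c_gt0 : (0 < #|'C_K(S)|)%N := cardG_gt0 _.
set z := #|'C_K(S)| in c_gt0 card_quo.
have z_gt0 : (0 < z ^ (size Ms).+1)%N by rewrite expn_gt0 c_gt0.
have prodE : (\prod_(M <- Ms) #|Sylows_over p G M| * z ^ size Ms
    = \prod_(M <- Ms) #|Sylows_over p (G / K) (M / K)|
      * \prod_(M <- Ms) #|'C_K(M)|)%N.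
  rewrite -big_split -(eq_big_seq _ (fun M h => card_quo M (sMP M h))).
  by rewrite big_split /= big_const_seq count_predT iter_muln_1.
have quo1E := card_quo 1%G (sub1G P).
rewrite cent1T setIT quo1 in quo1E.
rewrite -(leq_pmul2r z_gt0) expnS mulnACA prodE card_quo //.
rewrite mulnACA [leqRHS]mulnACA -expnMn quo1E card_quo // expnMn.
by rewrite [leqRHS]mulnACA leq_mul.
Qed.

(** A product of two ratios, each equal to 1 or at least [q], is again equal to
    1 or at least [q]. *)
Lemma Sylows_over_gap (p q : nat) (gT : finGroupType) (G P M : {group gT}) :
    prime p -> p_solvable p G -> p.-group P -> P \subset G -> M <| P ->
    (forall m, 1 < m -> prime_power m -> m = 1 %[mod p] -> q <= m)%N ->
  #|Sylows_over p G M| = #|Sylows_over p G P| \/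
  (q * #|Sylows_over p G P| <= #|Sylows_over p G M|)%N.
Proof.
move=> pr_p solG pP sPG nsMP q_min; move: gT G solG P M pP sPG nsMP.
apply: (p_solvable_ind (Phi := fun gT G =>
  forall P M : {group gT}, _ -> _ -> _ -> _)).
  by move=> gT P M _ /trivGP-> /normal_sub/trivGP->; left.
move=> gT G K nsKG piK IH P M pP sPG nsMP.
have [sMP nMP] := andP nsMP; have sMG := subset_trans sMP sPG.
have nKP : P \subset 'N(K) := subset_trans sPG (normal_norm nsKG).
have {}IH := IH _ _ (quotient_pgroup K pP) (quotientS K sPG)
  (quotient_normal K nsMP).
case: piK => [pK | p'K].
  by rewrite !(card_Sylows_over_pquotient pK nsKG).
have [S sylS] := Sylow_exists p G.
have c_gt0 : (0 < #|'C_K(S)|)%N := cardG_gt0 _.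
have cardP := card_Sylows_over_p'quotient p'K nsKG pP sPG sylS.
have cardM :=
  card_Sylows_over_p'quotient p'K nsKG (pgroupS sMP pP) sMG sylS.
have le_quo : (#|Sylows_over p (G / K) (P / K)|
                 <= #|Sylows_over p (G / K) (M / K)|)%N.
  apply/subset_leq_card/subsetP=> Q /Sylows_overP[sylQ sPQ].
  by apply/Sylows_overP; split=> //; apply: subset_trans (quotientS K sMP) sPQ.
case: (cent_gap pr_p pP p'K nKP nsMP q_min) => [eqC | gapC]; last first.
  right; rewrite -(leq_pmul2r c_gt0) -mulnA cardP cardM mulnCA.
  exact: leq_mul.
case: IH => /= [eqL | gapL].
  by left; apply/eqP; rewrite -(eqn_pmul2r c_gt0) cardP cardM eqC eqL.
by right; rewrite -(leq_pmul2r c_gt0) -mulnA cardP cardM eqC mulnA leq_mul.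
Qed.

(** * Maximal subgroups of p-groups *)
Lemma comaximal_maximal (p : nat) (gT : finGroupType) (P : {group gT}) :
  p.-group P -> comaximal P (enum [set M : {group gT} | maximal M P]).
Proof.
move=> pP; set S := [set M : {group gT} | maximal M P].
have memS (M : {group gT}) : M \in enum S -> maximal M P.
  by rewrite mem_enum inE.
apply/andP; split; first by apply/allP=> M /memS/(p_maximal_normal pP).
have := enum_uniq S; rewrite uniq_pairwise; move: memS.
elim: (enum S) => //= M Ms IH maxS /andP[neqM pairMs].
rewrite IH ?andbT // => [|N MsN]; last by rewrite maxS // inE MsN orbT.
apply/allP=> N MsN; have maxM := maxS M (mem_head M Ms).
have maxN : maximal N P by rewrite maxS // inE MsN orbT.
apply/eqP/(mulg_normal_maximal (p_maximal_normal pP maxM)) => //.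
  exact: proper_sub (maxgroupp maxN).
apply: contra (allP neqM N MsN) => sNM; apply/eqP/val_inj.
have /maxgroupP[_ maxN'] := maxN.
by apply: maxN' => //; apply: maxgroupp maxM.
Qed.

(** The maximal subgroups have order [m = #|P| / p] and cover the noncyclic
    group [P]; counting nontrivial elements, [p * m - 1] is at most
    [m - 1] times their number, which therefore exceeds [p]. *)
Lemma card_maximal_noncyclic (p : nat) (gT : finGroupType) (P : {group gT}) :
    prime p -> p.-group P -> ~~ cyclic P ->
  (p < #|[set M : {group gT} | maximal M P]|)%N.
Proof.
move=> pr_p pP ncP; set S := [set M : {group gT} | maximal M P].
have covP : P^# \subset \bigcup_(M in S) M^#.
  apply/subsetP=> x /setD1P[ntx Px].
  have sxP : <[x]> \subset P by rewrite cycle_subG.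
  have [defP | [M maxM sxM]] := maximal_exists sxP.
    by case/cyclicP: ncP; exists x; rewrite -defP.
  by apply/bigcupP; exists M; rewrite !inE // ntx -cycle_subG.
have p_dvd_P : p %| #|P|.
  have ntP : P :!=: 1 by apply: contra ncP => /eqP->; apply: cyclic1.
  by have [] := pgroup_pdiv pP ntP.
have [m cardP] : exists m, #|P| = (m * p)%N by apply/dvdnP.
have cardM (M : {group gT}) : M \in S -> #|M^#| = m.-1.
  rewrite inE => maxM; rewrite cardsDS ?sub1G // cards1 subn1; congr _.-1.
  apply/eqP; rewrite -(eqn_pmul2r (prime_gt0 pr_p)) -cardP.
  rewrite -{1}(p_maximal_index pP maxM) Lagrange //.
  exact: proper_sub (maxgroupp maxM).
have : (#|P^#| <= #|S| * m.-1)%N.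
  rewrite -sum_nat_const -(eq_bigr _ cardM).
  apply: leq_trans (subset_leq_card covP) _.
  elim/big_rec2: _ => [|M n A _ leA]; first by rewrite cards0.
  by apply: leq_trans (leq_card_setU _ _) _; rewrite leq_add2l.
have m_gt0 : (0 < m)%N by move: (cardG_gt0 P); rewrite cardP muln_gt0 => /andP[].
rewrite cardsDS ?sub1G // cards1 cardP.
by have p_gt1 := prime_gt1 pr_p; move: #|S| => k; nia.
Qed.

(** * The number of Sylow subgroups *)
Theorem theorem7 (p : nat) (p_prime : prime p)
    (gT : finGroupType) (G : {group gT})
    (G_p_solvable : p_solvable p G)
    (G_redundant : exists P : {group gT}, redundant_Sylow p G P)
    (q : nat) (q_smallest : smallest_prime_power_1_mod p q) :
  (q ^ p.+1 <= num_Sylow p G)%N.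
Proof.
have [P [sylP redP]] := G_redundant; have [sPG pP _] := and3P sylP.
have [q_gt1 _ _ q_min] := q_smallest.
pose isolating (X : {group gT}) := (#|Sylows_over p G X| == 1)%N.
have isoP : isolating P.
  rewrite /isolating; apply/cards1P; exists P; apply/setP=> Q.
  rewrite in_set1; apply/Sylows_overP/eqP=> [[sylQ sPQ] | -> //].
  by apply: val_inj; apply: (sub_pHall sylP _ sPQ (pHall_sub sylQ));
     apply: pHall_pgroup sylQ.
have [Q /mingroupP[isoQ minQ] sQP] := mingroup_exists isoP.
have [pQ sQG] := (pgroupS sQP pP, subset_trans sQP sPG).
have ncQ : ~~ cyclic Q.
  apply/negP=> /cyclicP[x defQ].
  have Px : x \in P by rewrite (subsetP sQP) // defQ cycle_id.
  have [R [sylR neqRP Rx]] := redP x (subsetP sPG x Px) (mem_p_elt pP Px).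
  case/negP: neqRP; have /cards1P[T oneT] := isoQ.
  have inT (Y : {group gT}) : p.-Sylow(G) Y -> x \in Y -> Y = T.
    move=> sylY Yx; apply/set1P; rewrite -oneT; apply/Sylows_overP.
    by rewrite defQ cycle_subG.
  by rewrite (inT R) // (inT P).
set S := [set M : {group gT} | maximal M Q].
have gapS (M : {group gT}) : M \in enum S -> (q <= #|Sylows_over p G M|)%N.
  rewrite mem_enum inE => maxM.
  case: (Sylows_over_gap p_prime G_p_solvable pQ sQG
           (p_maximal_normal pQ maxM) q_min) => [eqMQ | ]; last first.
    by rewrite (eqP isoQ) muln1.
  have ltMQ : M \proper Q by case/maxgroupP: maxM.
  have defM : M :=: Q by apply: minQ (proper_sub ltMQ); rewrite /isolating eqMQ.
  by rewrite defM properxx in ltMQ.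
have := Sylows_over_comaximal p_prime G_p_solvable pQ sQG (comaximal_maximal pQ).
rewrite (eqP isoQ) exp1n mul1n muln1 -/S.
have -> : #|Sylows_over p G 1| = num_Sylow p G.
  by apply: eq_card => R; rewrite inE sub1G andbT.
apply: leq_trans; apply: (@leq_trans (q ^ #|S|)).
  by rewrite leq_pexp2l ?card_maximal_noncyclic // ltnW.
rewrite cardE -(count_predT (enum S)) -iter_muln_1 -big_const_seq.
by rewrite big_seq [leqRHS]big_seq; apply: leq_prod.
Qed.
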